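(* Let $G$ be a chain graph on a finite vertex set $V$ and let $A\subseteq V$ be set by intervention, $x_a=a_0$ for every $a\in A$. Let $\hat G$ be obtained from $G$ by the redirection procedure. Then $G$ and $\hat G$ admit the same factorization decomposition.
   Context: Chain graph: edges undirected ($u-w$) or directed ($u\to w$), no partially directed cycle. $pa(v)=\{u:u\to v\}$, $nb(v)=\{u:u-v\}$; chain components are connected components of the undirected edges; $pa(\tau)=\bigcup_{v\in\tau}pa(v)\setminus\tau$, $bd(\tau)=\bigcup_{v\in\tau}(pa(v)\cup nb(v))\setminus\tau$; $G_S$ induced subgraph; moral graph $K^m$: $u,w$ adjacent iff adjacent in $K$ or both in $bd(\tau)$ for some chain component $\tau$ of $K$. Redirection procedure: for every $u\in A$ and every undirected edge $u-w$, replace it by the directed edge $u\to w$; then remove all directed edges pointing to a vertex of $A$. Factorization with intervention: a density $f$ on $\times_{v\in V}\mathcal{X}_v$ factorizes according to a chain graph $K$ with $A$ intervened if configurations with $x_a\neq a_0$ for some $a\in A$ have probability zero and $f(x\|x_A)=\prod_\tau f(x_{\tau\setminus A}\mid x_{pa(\tau)},x_{\tau\cap A})$ over chain components $\tau$ of $K$, with $f(x_{\tau\setminus A}\mid x_{pa(\tau)},x_{\tau\cap A})=Z^{-1}(x_{pa(\tau)},x_{\tau\cap A})\prod_{h\in\mathcal{C}}\psi_h(x)$, $\mathcal{C}$ the maximal cliques of $(K_{\tau\cup pa(\tau)})^m$, $\psi_h\ge0$ depending only on $x_h$, $Z=\int_{\mathcal{X}_{\tau\setminus A}}\prod_{h\in\mathcal{C}}\psi_h\,d\mu_{\tau\setminus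 A}$. Two chain graphs admit the same factorization decomposition if every density factorizing according to one (with $A$ intervened) factorizes according to the other, and vice versa. *)

(* Defs.v *)
From HB Require Import structures.
From mathcomp Require Import all_boot all_order all_algebra.
From mathcomp Require Import all_classical all_reals all_analysis.

Set Implicit Arguments.
Unset Strict Implicit.
Unset Printing Implicit Defensive.

Import Order.TTheory GRing.Theory Num.Theory.

Local Open Scope classical_set_scope.
Local Open Scope ring_scope.

Record mixed_graph (V : finType) := MixedGraph {
  und : rel V;  (* und K u w : u - w *)
  dir : rel V   (* dir K u w : u -> w *)
}.

Section Graphs.
Context {V : finType}.
Implicit Types (K : mixed_graph V) (S t h A : {set V}) (u v w : V).

Definition semidir K : rel V := fun u w => und K u w || dir K u w.

(* Cycles of length 1 and 2 are included, so that a chain graph has no loop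
   and at most one edge between any two vertices. *)
Definition no_partially_directed_cycle K :=
  forall c : seq V, ucycle (semidir K) c ->
    ~ exists2 u, u \in c & dir K u (next c u).

Definition is_chain_graph K :=
  [/\ symmetric (und K), irreflexive (und K) & no_partially_directed_cycle K].

Definition pa K v : {set V} := [set u | dir K u v]%SET.
Definition nb K v : {set V} := [set u | und K u v]%SET.

Definition pa_set K t : {set V} := (\bigcup_(v in t) pa K v :\: t)%SET.
Definition bd_set K t : {set V} :=
  (\bigcup_(v in t) (pa K v :|: nb K v) :\: t)%SET.

Definition chain_components K : {set {set V}} :=
  [set [set w | connect (und K) v w] | v in [set: V]]%SET.

(* The subgraph on S keeps V as its type of vertices; a vertex outside S is
   isolated in it, hence affects neither boundaries nor moral edges. *)
Definition induced K S := MixedGraph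
  (fun u w => [&& u \in S, w \in S & und K u w])
  (fun u w => [&& u \in S, w \in S & dir K u w]).

Definition adjacent K : rel V := fun u w => [|| und K u w, dir K u w | dir K w u].

Definition moral K : rel V := fun u w =>
  (u != w) && (adjacent K u w ||
    [exists t in chain_components K, (u \in bd_set K t) && (w \in bd_set K t)]).

(* h is complete in the moral graph of the subgraph induced by S *)
Definition moral_complete K S h :=
  (h \subset S) &&
  [forall u in h, forall w in h, (u != w) ==> moral (induced K S) u w].

Definition moral_cliques K S : {set {set V}} :=
  [set h | maxset (moral_complete K S) h]%SET.

(* An undirected edge inside A is replaced by both arrows, which the second
   step then deletes. *)
Definition orient_edges K A := MixedGraph
  (fun u w => [&& und K u w, u \notin A & w \notin A])
  (fun u w => dir K u w || (u \in A) && und K u w).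

Definition delete_arrows_into K A := MixedGraph
  (und K)
  (fun u w => dir K u w && (w \notin A)).

Definition redirect_graph K A := delete_arrows_into (orient_edges K A) A.

Lemma redirect_is_chain_graph K A :
  is_chain_graph K -> is_chain_graph (redirect_graph K A).
Proof.
case=> sK iK cK; split=> [u w|u|c /andP[cc uqc] [u uc duw]].
- by rewrite /= sK [(u \notin A) && _]andbC.
- by rewrite /= iK.
have cA w : w \in c -> w \notin A.
  by move=> /(prev_cycle cc)/orP[/and3P[]//|/andP[_ ->]].
apply: (cK c).
  apply/andP; split=> //; apply: (sub_in_cycle _ _ cc); last exact/allP/cA.
  move=> x y /negPf xA _ /orP[/and3P[xy _ _]|/andP[/orP[xy|/andP[]]]].
  - by rewrite /semidir xy.
  - by rewrite /semidir xy orbT.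
  - by rewrite xA.
exists u => //; move: duw => /andP[/orP[//|/andP[]]].
by rewrite (negPf (cA _ uc)).
Qed.

End Graphs.

Record chain_graph (V : finType) := ChainGraph {
  cg_graph :> mixed_graph V;
  cg_chain : is_chain_graph cg_graph
}.

Definition redirect (V : finType) (G : chain_graph V) (A : {set V}) :=
  ChainGraph (redirect_is_chain_graph A (cg_chain G)).

Section ProductSpace.
Context {V : finType} {d : V -> measure_display}.
Variable X : forall v, measurableType (d v).

Definition cylinders : set (set (forall v, X v)) :=
  [set C | exists v, exists2 B : set (X v),
     measurable B & C = [set x | B (x v)]].

Definition prodspace := g_sigma_algebraType cylinders.

Definition upd (v : V) (p : prodspace * X v) : prodspace := eqtype.dfwith p.1 p.2.

Lemma measurable_coord v : measurable_fun [set: prodspace] (fun x => x v).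
Proof.
move=> _ B mB; rewrite setTI; apply: sub_sigma_algebra.
by exists v, B.
Qed.

Lemma measurable_upd v : measurable_fun [set: prodspace * X v] (@upd v).
Proof.
apply: measurability => // _ [_ [w [B mB ->]] <-]; rewrite setTI.
rewrite -[X in measurable X]setTI.
case: (eqVneq v w) B mB => [<-|vw] B mB.
  rewrite [X in _ `&` X](_ : _ = snd @^-1` B); first exact: measurable_snd.
  by apply/seteqP; split=> -[x y] /=; rewrite /upd /= dfwith_in.
rewrite [X in _ `&` X](_ : _ = (fun p => p.1 w) @^-1` B); last first.
  by apply/seteqP; split=> -[x y] /=; rewrite /upd /= dfwith_out.
have mc : measurable_fun [set: prodspace * X v] (fun p => p.1 w).
  exact: (measurableT_comp (@measurable_coord w) measurable_fst).
exact: mc.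
Qed.

Context {R : realType}.
Variable mu : forall v, {sigma_finite_measure set (X v) -> \bar R}.

Definition adjoin (m : {measure set prodspace -> \bar R}) (v : V) :
    set prodspace -> \bar R :=
  pushforward (m \x mu v)%E (@upd v).

Section AdjoinMeasure.
Variables (m : {measure set prodspace -> \bar R}) (v : V).

Let adjoin0 : adjoin m v set0 = 0%E.
Proof. by rewrite /adjoin /pushforward preimage_set0 measure0. Qed.

Let adjoin_ge0 B : (0 <= adjoin m v B)%E.
Proof. by rewrite /adjoin /pushforward; exact: measure_ge0. Qed.

Let adjoin_sigma_additive : semi_sigma_additive (adjoin m v).
Proof.
have mpre B : measurable B -> measurable (@upd v @^-1` B).
  by move=> mB; rewrite -[X in measurable X]setTI; exact: measurable_upd.
move=> F mF tF mUF; rewrite /adjoin /pushforward preimage_bigcup.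
apply: measure_semi_sigma_additive; first by move=> n; exact: mpre.
- apply/trivIsetP => /= i j _ _ ij; rewrite -preimage_setI.
  by move/trivIsetP : tF => /(_ _ _ _ _ ij) ->//; rewrite preimage_set0.
- by rewrite -preimage_bigcup; exact: mpre.
Qed.

HB.instance Definition _ := isMeasure.Build _ _ _
  (adjoin m v) adjoin0 adjoin_ge0 adjoin_sigma_additive.

End AdjoinMeasure.

Fixpoint prodmeas_seq (s : seq V) (x : prodspace) :
    {measure set prodspace -> \bar R} :=
  if s is v :: s' then adjoin (prodmeas_seq s' x) v else dirac x.

(* The product of the mu v for v in S and of the Dirac masses at x v for v
   outside S: integrating against it integrates out x_S with respect to mu_S,
   the other coordinates being frozen at those of x. *)
Definition prodmeas (S : {set V}) (x : prodspace) :
    {measure set prodspace -> \bar R} := prodmeas_seq (enum S) x.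

Lemma measurable_box (B : forall v, set (X v)) :
  (forall v, measurable (B v)) ->
  measurable ([set z | forall v, B v (z v)] : set prodspace).
Proof.
move=> mB.
rewrite [X in measurable X](_ : _ =
    \bigcap_(v in [set: V]) [set z : prodspace | B v (z v)]); last first.
  by apply/seteqP; split=> z /= Bz v; [move=> _|]; exact: (Bz v).
apply: fin_bigcap_measurable => // v _.
by rewrite -[X in measurable X]setTI; exact: measurable_coord.
Qed.

Lemma prodmeas_seq_box (s : seq V) (x : prodspace) (B : forall v, set (X v)) :
  uniq s -> (forall v, measurable (B v)) -> (forall v, v \notin s -> B v (x v)) ->
  prodmeas_seq s x [set z | forall v, B v (z v)] = (\prod_(v <- s) mu v (B v))%E.
Proof.
elim: s B => [|v s IH] B /=.
  move=> _ mB Bx; rewrite big_nil diracE mem_set//= => v; exact: Bx.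
move=> /andP[vs us] mB Bx.
pose B' := eqtype.dfwith B (setT : set (X v)).
have B'v : B' v = setT by rewrite /B' eqtype.dfwith_in.
have B'w w : v != w -> B' w = B w by move=> vw; rewrite /B' eqtype.dfwith_out.
have mB' w : measurable (B' w).
  by case: (eqVneq v w) => [<-|/B'w ->//]; rewrite B'v.
rewrite /adjoin /pushforward.
rewrite (_ : _ @^-1` _ = [set z | forall w, B' w (z w)] `*` B v); last first.
  apply/seteqP; split=> -[z y] /=; rewrite /upd /=.
    move=> H; split=> [w|]; last by have := H v; rewrite eqtype.dfwith_in.
    case: (eqVneq v w) => [<-|vw]; first by rewrite B'v.
    by have := H w; rewrite B'w// eqtype.dfwith_out.
  move=> [H Hv] w; case: (eqVneq v w) => [<-|vw].
    by rewrite eqtype.dfwith_in.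
  by rewrite eqtype.dfwith_out// -B'w.
rewrite product_measure1E//; last exact: measurable_box.
rewrite IH//; last first.
  move=> w ws; case: (eqVneq v w) => [<-|vw]; first by rewrite B'v.
  by rewrite B'w//; apply: Bx; rewrite inE negb_or eq_sym vw.
rewrite big_cons muleC; congr (_ * _)%E.
rewrite big_seq [RHS]big_seq; apply: eq_bigr => w ws; rewrite B'w//.
by apply: contraNneq vs => ->.
Qed.

Lemma prodmeas_box (S : {set V}) (x : prodspace) (B : forall v, set (X v)) :
  (forall v, measurable (B v)) -> (forall v, v \notin S -> B v (x v)) ->
  prodmeas S x [set z | forall v, B v (z v)] = (\prod_(v in S) mu v (B v))%E.
Proof.
move=> mB Bx; rewrite /prodmeas prodmeas_seq_box ?enum_uniq ?big_enum//.
by move=> v; rewrite mem_enum; exact: Bx.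
Qed.

(* Densities are taken with respect to the product of the mu v for v outside A
   and of the point masses at a0 v for v in A; the values of a0 outside A are
   irrelevant. *)
Definition base_measure (A : {set V}) (a0 : prodspace) := prodmeas (~: A) a0.

Definition is_density (A : {set V}) (a0 : prodspace) (f : prodspace -> R) :=
  [/\ measurable_fun setT f, forall x, 0 <= f x &
      (\int[base_measure A a0]_x (f x)%:E)%E = 1%E].

Definition depends_only_on (h : {set V}) (psi : prodspace -> R) :=
  forall x y : prodspace, (forall v, v \in h -> x v = y v) -> psi x = psi y.

Definition is_potential (h : {set V}) (psi : prodspace -> R) :=
  [/\ measurable_fun setT psi, forall x, 0 <= psi x & depends_only_on h psi].

Section Factorization.
Variable K : chain_graph V.
Implicit Types (A t : {set V}) (psi : {set V} -> prodspace -> R).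

Definition potential_prod t psi (x : prodspace) : R :=
  \prod_(h in moral_cliques K (t :|: pa_set K t)%SET) psi h x.

Definition partition_fun A t psi (x : prodspace) : \bar R :=
  (\int[prodmeas (t :\: A)%SET x]_z (potential_prod t psi z)%:E)%E.

(* Since 0^-1 = 0 and fine +oo = 0, the factor is 0 where the normalizing
   integral is 0 or infinite: a density that factorizes puts no mass there. *)
Definition conditional_factor A t psi (x : prodspace) : R :=
  (fine (partition_fun A t psi x))^-1 * potential_prod t psi x.

Definition factorizes A (a0 : prodspace) (f : prodspace -> R) :=
  (forall x, (exists2 a, a \in A & x a <> a0 a) -> f x = 0) /\
  exists psi : {set V} -> {set V} -> prodspace -> R,
    (forall t h, t \in chain_components K ->
       h \in moral_cliques K (t :|: pa_set K t)%SET -> is_potential h (psi t h)) /\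
    {ae base_measure A a0, forall x, (forall a, a \in A -> x a = a0 a) ->
       f x = \prod_(t in chain_components K) conditional_factor A t (psi t) x}.

End Factorization.

Definition same_factorization (K L : chain_graph V) A a0 :=
  forall f : prodspace -> R, is_density A a0 f ->
    factorizes K A a0 f <-> factorizes L A a0 f.

End ProductSpace.

(* Main.v *)
(** Redirection splits a chain component t of G into the chain components s of
    the new graph that are contained in t.  After freezing the coordinates in A
    at a0, a potential on a clique h depends only on h minus A, which is complete
    in the other moral graph as well (from G to the new graph: as soon as it
    meets a block s).
    Hence, on [x_A = a0], the unnormalized factor of t is the product of those
    of its blocks s, up to a function of the coordinates outside t minus A,
    and by Tonelli the same holds for the normalizers. So one product of
    conditional factors dominates the other pointwise; they may differ only
    where a normalizer is 0 or infinite. A product of conditional factors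
    always has integral at most 1 (integrate out the components from the
    terminal ones upwards), whereas a density has integral 1: the dominated
    density equals the dominating product almost everywhere. *)

From HB Require Import structures.
Require Import Defs.
From mathcomp Require Import all_boot all_order all_algebra.

Set Implicit Arguments.
Unset Strict Implicit.
Unset Printing Implicit Defensive.

(** * Chain components and moral cliques *)

Section ChainGraphs.
Context {V : finType}.
Implicit Types (K G : chain_graph V) (t h A : {set V}) (u v w p : V).

Definition component (K : mixed_graph V) v : {set V} := [set w | connect (und K) v w]%SET.

(** Union of the components that meet [h]. Taken in [G] it sends a block to the component it was cut
    from; taken in the redirected graph it sends the part of a clique outside [A] to its block. *)
Definition saturation (K : mixed_graph V) h : {set V} :=
  [set w | [exists v in h, connect (und K) v w]]%SET.

Lemma und_connect_sym K : connect_sym (und K).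
Proof. by apply: sym_connect_sym; case: (cg_chain K). Qed.

(** The arrow followed by a path back would be a partially directed cycle. The path is first
    shortened, since cycles are required to be duplicate free. *)
Lemma dir_no_return K u w : dir K u w -> ~~ connect (semidir K) w u.
Proof.
move=> uw; apply/negP => /connectP[p0 wp0]; case/shortenP: wp0 => p wp up _ ulast.
(* Listing the cycle from [u] lets the successor of [u] compute to [w]; its rotation is the given
   path, which supplies uniqueness and adjacency. *)
have rotc : rot 1 (u :: belast w p) = w :: p by rewrite rot1_cons ulast -lastI.
case: (cg_chain K) => _ _ /(_ (u :: belast w p)); apply.
  rewrite /ucycle -(rot_uniq 1) -(rot_cycle 1) rotc up andbT /= rcons_path wp.
  by rewrite -ulast /semidir uw orbT.
exists u; first exact: mem_head.
by case: p ulast {wp up rotc} => [|y p] /= ulast; rewrite eqxx ?{2}ulast.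
Qed.

Lemma connect_und_semidir K u w : connect (und K) u w -> connect (semidir K) u w.
Proof.
by apply: connect_sub => x y xy; apply: connect1; rewrite /semidir xy.
Qed.

Lemma dir_not_connected K u w : dir K u w -> ~~ connect (und K) u w.
Proof.
move=> /dir_no_return; apply: contra; rewrite und_connect_sym.
exact: connect_und_semidir.
Qed.

Lemma component_chain K v : component K v \in chain_components K.
Proof. by apply/imsetP; exists v; rewrite ?inE. Qed.

Lemma mem_component K v : v \in component K v.
Proof. by rewrite inE. Qed.

Lemma chain_componentE K t v : t \in chain_components K -> v \in t ->
  t = component K v.
Proof.
case/imsetP => u _ ->; rewrite inE => uv; apply/setP => w; rewrite !inE.
exact: (same_connect (@und_connect_sym K)).
Qed.

Lemma chain_component_connect K t u v : t \in chain_components K ->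
  u \in t -> v \in t -> connect (und K) u v.
Proof. by move=> tK ut; rewrite (chain_componentE tK ut) inE. Qed.

Lemma chain_component_closed K t u v : t \in chain_components K ->
  u \in t -> connect (und K) u v -> v \in t.
Proof. by move=> tK ut uv; rewrite (chain_componentE tK ut) inE. Qed.

Lemma chain_component_exists K t : t \in chain_components K -> exists v, v \in t.
Proof. by case/imsetP => v _ ->; exists v; rewrite inE. Qed.

Lemma chain_component_disjoint K t1 t2 v :
  t1 \in chain_components K -> t2 \in chain_components K ->
  v \in t1 -> v \in t2 -> t1 = t2.
Proof.
by move=> h1 h2 v1 v2; rewrite (chain_componentE h1 v1) (chain_componentE h2 v2).
Qed.

Lemma pa_setP (K : mixed_graph V) t p :
  reflect (p \notin t /\ exists2 v, v \in t & dir K p v) (p \in pa_set K t).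
Proof.
rewrite inE; apply: (iffP andP) => -[pt].
  by case/bigcupP => v vt; rewrite inE => pv; split => //; exists v.
by case=> v vt pv; split => //; apply/bigcupP; exists v; rewrite ?inE.
Qed.

Lemma bd_setP (K : mixed_graph V) t p :
  reflect (p \notin t /\ exists2 v, v \in t & dir K p v || und K p v)
    (p \in bd_set K t).
Proof.
rewrite inE; apply: (iffP andP) => -[pt].
  by case/bigcupP => v vt; rewrite !inE => pv; split => //; exists v.
by case=> v vt pv; split => //; apply/bigcupP; exists v; rewrite ?inE.
Qed.

Lemma dir_pa_set K t p v : t \in chain_components K -> v \in t -> dir K p v ->
  p \in pa_set K t.
Proof.
move=> tK vt pv; apply/pa_setP; split; last by exists v.
apply/negP => pt; move: (dir_not_connected pv).
by rewrite (chain_component_connect tK pt vt).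
Qed.

(** Take a component with the largest number of ancestors. If it contained a parent of some [t] in
    [D], then [t] would have strictly more ancestors. *)
Lemma exists_terminal_component K (D : {set {set V}}) :
  D \subset chain_components K -> D != set0 ->
  exists2 t0, t0 \in D & forall t, t \in D -> [disjoint t0 & pa_set K t].
Proof.
move=> /subsetP DK /set0Pn[t1 t1D].
pose anc t : {set V} := [set u | [exists v in t, connect (semidir K) u v]].
case: (arg_maxnP (fun t => #|anc t|) t1D) => t0 t0D maxt0.
exists t0 => // t tD; rewrite -setI_eq0; apply/eqP/setP => p; rewrite in_setI in_set0.
apply/negP => /andP[pt0 /pa_setP[_ [v vt pv]]].
have: #|anc t0| < #|anc t|.
  apply/proper_card/properP; split.
    apply/subsetP => u; rewrite !inE => /exists_inP[x xt0 ux].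
    apply/exists_inP; exists v => //; apply: (connect_trans ux).
    apply: (@connect_trans _ _ p); last by apply: connect1; rewrite /semidir pv orbT.
    exact/connect_und_semidir/(chain_component_connect (DK _ t0D)).
  (* The child [v] is the additional ancestor: a semidirected path from [v] to [t0] would continue
     inside [t0] to its parent [p]. *)
  exists v; first by rewrite inE; apply/exists_inP; exists v.
  rewrite inE; apply/negP => /exists_inP[x xt0 vx].
  move: (dir_no_return pv); rewrite (connect_trans vx)//.
  exact/connect_und_semidir/(chain_component_connect (DK _ t0D)).
by move=> /leq_trans/(_ (maxt0 _ tD)); rewrite ltnn.
Qed.

Lemma connect_induced K t (S : {set V}) u v : t \in chain_components K ->
  t \subset S -> u \in t -> connect (und K) u v -> connect (und (induced K S)) u v.
Proof.
move=> tK /subsetP tS + /connectP[q]; elim: q u => [|w q IH] u ut /=.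
  by move=> _ ->.
move=> /andP[uw wq] vq; have wt : w \in t by exact: chain_component_closed (connect1 uw).
apply: connect_trans (IH _ wt wq vq); apply: connect1.
by rewrite /= !tS.
Qed.

Lemma induced_component K t : t \in chain_components K ->
  t \in chain_components (induced K (t :|: pa_set K t)).
Proof.
move=> tK; case: (chain_component_exists tK) => v vt.
apply/imsetP; exists v => //; apply/setP => w; rewrite inE; apply/idP/idP.
  move=> wt; apply: (connect_induced tK) => //; first exact: subsetUl.
  exact: chain_component_connect tK _ _.
move=> vw; apply: (chain_component_closed tK vt).
by apply: connect_sub vw => x y /= /and3P[_ _ xy]; exact: connect1.
Qed.

(** In the subgraph on [t :|: pa_set K t], the boundary of [t] is [pa_set K t] and every other
    component has its boundary inside that set. So moralization adds edges between parents of [t]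
    only. *)
Lemma moral_completeP K t h : t \in chain_components K ->
  reflect (h \subset t :|: pa_set K t /\ {in h &, forall u w, u != w ->
     [|| (u \in pa_set K t) && (w \in pa_set K t), und K u w, dir K u w | dir K w u]})
    (moral_complete K (t :|: pa_set K t) h).
Proof.
move=> tK; set S := t :|: pa_set K t; set P := pa_set K t.
have paS : bd_set (induced K S) t = P.
  apply/setP => p; apply/bd_setP/idP.
    case=> pt [v vt] /orP[] /and3P[_ _ pv]; first exact: (dir_pa_set tK vt).
    case/negP: pt; apply: (chain_component_closed tK vt).
    by rewrite und_connect_sym connect1.
  move=> pP; have /pa_setP[pt [v vt pv]] := pP; split => //.
  by exists v => //; apply/orP; left; rewrite /= !in_setU pP vt pv orbT.
(* An undirected edge into [t'] would put [u] in [t']. An arrow starting in [t] would end in [t] or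
   in a parent of [t], and either creates a partially directed cycle. *)
have bdP t' u : t' \in chain_components (induced K S) ->
    u \in bd_set (induced K S) t' -> u \in S -> u \in P.
  move=> /imsetP[x _ ->] /bd_setP[ux [v]]; rewrite inE => xv.
  case/orP => /and3P[uS vS uv] _; last first.
    case/negP: ux; rewrite inE; apply: (connect_trans xv); apply: connect1.
    by rewrite /= vS uS; case: (cg_chain K) => ->.
  case/setUP: uS => // ut; case/setUP: vS => [vt|/pa_setP[_ [y yt vy]]].
    by move: (dir_not_connected uv); rewrite (chain_component_connect tK).
  move: (dir_no_return uv); rewrite (@connect_trans _ _ y)//.
    by apply: connect1; rewrite /semidir vy orbT.
  exact/connect_und_semidir/(chain_component_connect tK).
apply: (iffP andP) => -[hS].
  move=> /forall_inP H; split=> // u w uh wh uw.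
  have uS := subsetP hS _ uh; have wS := subsetP hS _ wh.
  have /forall_inP/(_ _ wh) := H _ uh; rewrite uw /= /moral uw /=.
  case/orP.
    by rewrite /adjacent /= => /or3P[] /and3P[_ _ ->]; rewrite !orbT.
  case/exists_inP => t' t'K /andP[ub wb].
  by rewrite (bdP _ _ t'K ub uS) (bdP _ _ t'K wb wS).
move=> H; split=> //; apply/forall_inP => u uh; apply/forall_inP => w wh.
apply/implyP => uw; rewrite /moral uw /=.
have uS := subsetP hS _ uh; have wS := subsetP hS _ wh.
case/orP: (H _ _ uh wh uw).
  move=> uwP; apply/orP; right; apply/exists_inP; exists t; first exact: induced_component.
  by rewrite paS.
by rewrite /adjacent /= uS wS /= => ->.
Qed.

Lemma moral_cliques_complete K (S : {set V}) h :
  h \in moral_cliques K S -> moral_complete K S h.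
Proof. by rewrite inE => /maxsetp. Qed.

Lemma moral_clique_sub K (S : {set V}) h : h \in moral_cliques K S -> h \subset S.
Proof. by move=> /moral_cliques_complete/andP[]. Qed.

(** A fixed choice of maximal clique, so that potentials can be grouped by the clique that receives
    them. The default [set0] is never reached when [h] is complete. *)
Definition containing_clique (K : mixed_graph V) (S h : {set V}) : {set V} :=
  odflt set0 [pick m in moral_cliques K S | h \subset m].

Lemma containing_cliqueP K (S h : {set V}) : moral_complete K S h ->
  containing_clique K S h \in moral_cliques K S /\ h \subset containing_clique K S h.
Proof.
move=> /maxset_exists[m mm hm]; rewrite /containing_clique.
case: pickP => [m' /andP[] //|/(_ m)]; by rewrite inE mm hm.
Qed.

(** * Components and cliques of the redirected graph *)

Section Redirection.
Variables (G : chain_graph V) (A : {set V}).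
Let G' := redirect G A.

Lemma redirect_undE u w : und G' u w = [&& und G u w, u \notin A & w \notin A].
Proof. by []. Qed.

Lemma redirect_dirE u w :
  dir G' u w = (dir G u w || (u \in A) && und G u w) && (w \notin A).
Proof. by []. Qed.

Lemma connect_redirect u w : connect (und G') u w -> connect (und G) u w.
Proof. by apply: connect_sub => x y /and3P[xy _ _]; exact: connect1. Qed.

Lemma saturation_component t v : t \in chain_components G' -> v \in t ->
  saturation G t = component G v.
Proof.
move=> tG vt; apply/setP => w; rewrite !inE; apply/exists_inP/idP.
  case=> x xt; apply: connect_trans; apply: connect_redirect.
  exact: (chain_component_connect tG).
by exists v.
Qed.

Lemma saturation_chain t : t \in chain_components G' ->
  saturation G t \in chain_components G.
Proof.
move=> tG; case: (chain_component_exists tG) => v vt.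
by rewrite (saturation_component tG vt) component_chain.
Qed.

Lemma sub_saturation t : t \subset saturation G t.
Proof. by apply/subsetP => v vt; rewrite inE; apply/exists_inP; exists v. Qed.

(** The blocks of [t]. A vertex of [A] in [t] is a block by itself and contributes no integration
    variable. *)
Definition refinement t : {set {set V}} :=
  [set s in chain_components G' | saturation G s == t].

Lemma refinement_cover t : t \in chain_components G ->
  \bigcup_(s in refinement t) (s :\: A) = t :\: A.
Proof.
move=> tG; apply/setP => v; apply/bigcupP/idP.
  case=> s; rewrite inE => /andP[sG /eqP <-]; apply: subsetP.
  exact: setSD (sub_saturation s).
rewrite inE => /andP[vA vt]; exists (component G' v); last by rewrite in_setD vA mem_component.
rewrite inE component_chain (saturation_component (component_chain G' v) (mem_component G' v)).
by rewrite (chain_componentE tG vt) eqxx.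
Qed.

(** All new arrows start in [A], so this parent is inherited from [G]. In particular it lies outside
    the surrounding component, which keeps the integration variables of different blocks apart. *)
Lemma redirect_parent_outside t p : t \in chain_components G' -> p \in pa_set G' t ->
  p \notin A -> p \in pa_set G (saturation G t).
Proof.
move=> tG /pa_setP[pt [v vt]]; rewrite redirect_dirE => /andP[pv vA] pA.
move: pv; rewrite (negPf pA) /= orbF => pv.
by apply: (dir_pa_set (saturation_chain tG) _ pv); apply: subsetP vt; exact: sub_saturation.
Qed.

(** Between vertices outside [A], redirection creates neither edges nor common children, so every
    adjacency is inherited from [G]. *)
Lemma redirect_clique_complete t h : t \in chain_components G' ->
  h \in moral_cliques G' (t :|: pa_set G' t) ->
  moral_complete G (saturation G t :|: pa_set G (saturation G t)) (h :\: A).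
Proof.
move=> tG /moral_cliques_complete/(moral_completeP _ tG)[hS H].
apply/(moral_completeP _ (saturation_chain tG)); split.
  apply/subsetP => u; rewrite inE => /andP[uA /(subsetP hS)].
  case/setUP => [ut|up]; apply/setUP; [left|right].
    by apply: subsetP ut; exact: sub_saturation.
  exact: redirect_parent_outside.
move=> u w /setDP[uh uA] /setDP[wh wA] uw.
case/or4P: (H _ _ uh wh uw).
- by case/andP => up wp; rewrite !redirect_parent_outside.
- by rewrite redirect_undE => /and3P[-> _ _]; rewrite !orbT.
- by rewrite redirect_dirE (negPf uA) /= orbF => /andP[-> _]; rewrite !orbT.
- by rewrite redirect_dirE (negPf wA) /= orbF => /andP[-> _]; rewrite !orbT.
Qed.

Lemma clique_und t h u w : t \in chain_components G ->
  h \in moral_cliques G (t :|: pa_set G t) -> u \in h -> w \in h -> u != w ->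
  u \in t -> w \in t -> und G u w.
Proof.
move=> tG /moral_cliques_complete/(moral_completeP _ tG)[_ H] uh wh uw ut wt.
case/or4P: (H _ _ uh wh uw) => //.
- by case/andP => /pa_setP[]; rewrite ut.
- by move=> /dir_not_connected; rewrite (chain_component_connect tG).
- by move=> /dir_not_connected; rewrite (chain_component_connect tG).
Qed.

(** The other adjacencies are impossible: an undirected edge would put [p] in [t], and an arrow from
    [w] to [p] would close a cycle through a child of [p] in [t]. *)
Lemma clique_dir t h p w : t \in chain_components G ->
  h \in moral_cliques G (t :|: pa_set G t) -> p \in h -> w \in h ->
  p \in pa_set G t -> w \in t -> dir G p w.
Proof.
move=> tG /moral_cliques_complete/(moral_completeP _ tG)[_ H] ph wh pp wt.
have /pa_setP[pt [v vt pv]] := pp.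
have pw : p != w by apply: contraNneq pt => ->.
case/or4P: (H _ _ ph wh pw) => //.
- by case/andP => _ /pa_setP[]; rewrite wt.
- move=> /connect1; rewrite und_connect_sym => /(chain_component_closed tG wt).
  by rewrite (negPf pt).
- move=> /dir_no_return; rewrite (@connect_trans _ _ v)//.
    by apply: connect1; rewrite /semidir pv orbT.
  exact/connect_und_semidir/(chain_component_connect tG).
Qed.

(** Two such vertices are joined by an undirected edge that redirection keeps. Hence a clique meets
    at most one block outside [A]. *)
Lemma clique_connected t h u w : t \in chain_components G ->
  h \in moral_cliques G (t :|: pa_set G t) ->
  u \in (h :\: A) :&: t -> w \in (h :\: A) :&: t -> connect (und G') u w.
Proof.
move=> tG hG; rewrite !inE => /andP[/andP[uA uh] ut] /andP[/andP[wA wh] wt].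
have [->|uw] := eqVneq u w; first exact: connect0.
by apply: connect1; rewrite redirect_undE uA wA (clique_und tG hG uh wh).
Qed.

(** The vertex [v] does the work: the other vertices of the clique in [s] but outside [A] lie in the
    block of [v], and its vertices in [pa_set G s] still point to [v], because [v] is outside [A].
    Without such a [v], two parents might no longer have a child in a common block. *)
Lemma clique_redirect_complete t h v : t \in chain_components G' ->
  h \in moral_cliques G (saturation G t :|: pa_set G (saturation G t)) ->
  v \in (h :\: A) :&: t ->
  moral_complete G' (t :|: pa_set G' t) (h :\: A).
Proof.
move=> tG'; set s := saturation G t => hG; have sG := saturation_chain tG'.
have ts := subsetP (sub_saturation t).
rewrite !inE => /andP[/andP[vA vh] vt].
have hS := subsetP (moral_clique_sub hG).
have mem u : u \in h -> u \notin A -> (u \in t) || (u \in pa_set G' t) && (u \in pa_set G s).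
  move=> uh uA; case/setUP: (hS _ uh) => [us|up].
    have -> // : u \in t.
    apply: (chain_component_closed tG' vt); apply: (clique_connected sG hG).
      by rewrite in_setI in_setD vA vh ts.
    by rewrite in_setI in_setD uA uh us.
  rewrite up andbT; apply/orP; right; apply: (dir_pa_set tG' vt).
  by rewrite redirect_dirE vA (clique_dir sG hG uh vh up (ts _ vt)).
apply/(moral_completeP _ tG'); split.
  apply/subsetP => u; rewrite inE => /andP[uA uh]; apply/setUP.
  by case/orP: (mem _ uh uA) => [|/andP[]]; [left|right].
move=> u w /setDP[uh uA] /setDP[wh wA] uw.
case/orP: (mem _ uh uA) => [ut|/andP[up' up]]; case/orP: (mem _ wh wA) => [wt|/andP[wp' wp]].
- by rewrite redirect_undE uA wA (clique_und sG hG uh wh uw (ts _ ut) (ts _ wt)) ?orbT.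
- by rewrite (redirect_dirE w) uA (clique_dir sG hG wh uh wp (ts _ ut)) ?orbT.
- by rewrite (redirect_dirE u) wA (clique_dir sG hG uh wh up (ts _ wt)) ?orbT.
- by rewrite up' wp'.
Qed.

End Redirection.
End ChainGraphs.

From mathcomp Require Import all_classical all_reals all_analysis.
From mathcomp Require Import measurable_realfun.

Import Order.TTheory GRing.Theory Num.Theory.

Local Open Scope classical_set_scope.
Local Open Scope ring_scope.

(** * Integration against [prodmeas] *)

(** The measures [prodmeas_seq] are bundled as plain measures; here a sigma-finite structure is
    packed from the hypothesis so that Tonelli applies to them. *)
Lemma tonelli_sigma_finite d1 d2 (T1 : measurableType d1) (T2 : measurableType d2)
    (R : realType) (m1 : {measure set T1 -> \bar R})
    (m2 : {sigma_finite_measure set T2 -> \bar R}) (f : T1 * T2 -> \bar R) :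
  sigma_finite setT m1 -> measurable_fun setT f -> (forall x, 0 <= f x)%E ->
  (\int[m1 \x m2]_z f z = \int[m1]_x \int[m2]_y f (x, y))%E.
Proof.
move=> sf.
pose Sf := isSFinite.Build _ _ _ _ (sfinite_measure_sigma_finite sf).
pose sF := isSigmaFinite.Build _ _ _ _ sf.
pose m := HB.pack_for (SigmaFiniteMeasure.type T1 R) (Measure.sort m1) Sf sF.
exact: (fubini_tonelli1 (m1 := m)).
Qed.

Section IteratedIntegral.
Context {R : realType} {V : finType} {d : V -> measure_display}.
Context {X : forall v, measurableType (d v)}.
Variable mu : forall v, {sigma_finite_measure set (X v) -> \bar R}.
Implicit Types (v w : V) (F H : prodspace X -> \bar R) (s : seq V) (x y : prodspace X).
Local Open Scope ereal_scope.

Definition integrate_out v F : prodspace X -> \bar R :=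
  fun y => \int[mu v]_t F (upd (y, t)).

(** A left fold integrates the head of [s] first, in agreement with the outermost [adjoin] of
    [prodmeas_seq]. *)
Definition iter_int s F := foldl (fun H v => integrate_out v H) F s.

Lemma upd_in v (y : prodspace X) (t : X v) : upd (y, t) v = t.
Proof. exact: eqtype.dfwith_in. Qed.

Lemma upd_out v w (y : prodspace X) (t : X v) : v != w -> upd (y, t) w = y w.
Proof. exact: eqtype.dfwith_out. Qed.

Lemma updC v w (y : prodspace X) (t : X v) (r : X w) : v != w ->
  upd (upd (y, t), r) = upd (upd (y, r), t).
Proof.
move=> vw; apply: functional_extensionality_dep => u.
case: (eqVneq v u) => [<-|vu].
  by rewrite upd_out 1?eq_sym// !upd_in.
rewrite [RHS]upd_out//; case: (eqVneq w u) => [<-|wu]; first by rewrite !upd_in.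
by rewrite !upd_out.
Qed.

Lemma measurable_comp_upd v F : measurable_fun setT F ->
  measurable_fun setT (fun p : prodspace X * X v => F (upd p)).
Proof. by move=> mF; apply: (measurableT_comp mF); exact: measurable_upd. Qed.

Lemma measurable_upd_section v F y : measurable_fun setT F ->
  measurable_fun setT (fun t : X v => F (upd (y, t))).
Proof.
move=> mF; apply: (measurableT_comp (measurable_comp_upd mF)).
exact: pair1_measurable.
Qed.

Lemma integrate_out_ge0 v F : (forall x, 0 <= F x) ->
  forall x, 0 <= integrate_out v F x.
Proof. by move=> F0 x; apply: integral_ge0. Qed.

Lemma measurable_integrate_out v F : measurable_fun setT F ->
  (forall x, 0 <= F x) -> measurable_fun setT (integrate_out v F).
Proof.
move=> mF F0; rewrite /integrate_out.
apply: (measurable_fun_fubini_tonelli_F (m2 := mu v) (fun p => F (upd p))) => //.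
exact: measurable_comp_upd.
Qed.

Lemma iter_int_ge0 s F : (forall x, 0 <= F x) -> forall x, 0 <= iter_int s F x.
Proof.
elim: s F => //= v s IH F F0; apply: IH => x; exact: integrate_out_ge0.
Qed.

Lemma measurable_iter_int s F : measurable_fun setT F ->
  (forall x, 0 <= F x) -> measurable_fun setT (iter_int s F).
Proof.
elim: s F => //= v s IH F mF F0; apply: IH; last exact: integrate_out_ge0.
exact: measurable_integrate_out.
Qed.

Lemma iter_int_cat s1 s2 F : iter_int (s1 ++ s2) F = iter_int s2 (iter_int s1 F).
Proof. exact: foldl_cat. Qed.

Lemma eq_iter_int s F H : F =1 H -> iter_int s F = iter_int s H.
Proof. by move=> /funext ->. Qed.

Lemma le_integrate_out v F H : measurable_fun setT F -> measurable_fun setT H ->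
  (forall x, 0 <= F x) -> (forall x, F x <= H x) ->
  forall x, integrate_out v F x <= integrate_out v H x.
Proof.
move=> mF mH F0 FH x; apply: ge0_le_integral => //; exact: measurable_upd_section.
Qed.

Lemma le_iter_int s F H : measurable_fun setT F -> measurable_fun setT H ->
  (forall x, 0 <= F x) -> (forall x, F x <= H x) ->
  forall x, iter_int s F x <= iter_int s H x.
Proof.
elim: s F H => //= v s IH F H mF mH F0 FH.
have H0 x : 0 <= H x by exact: le_trans (FH x).
by apply: IH; [exact: measurable_integrate_out..|exact: integrate_out_ge0|
  exact: le_integrate_out].
Qed.

Lemma integrate_outC v w F : v != w -> measurable_fun setT F ->
  (forall x, 0 <= F x) ->
  integrate_out v (integrate_out w F) = integrate_out w (integrate_out v F).
Proof.
move=> vw mF F0; apply/funext => y; rewrite /integrate_out.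
rewrite (fubini_tonelli (m1 := mu v) (m2 := mu w)
   (fun p => F (upd (upd (y, p.1), p.2)))) //=.
  apply: eq_integral => r _; apply: eq_integral => t _; by rewrite updC.
apply: (measurableT_comp (measurable_comp_upd (v := w) mF)).
apply/prod_measurable_funP; split => /=; last exact: measurable_snd.
apply: (measurableT_comp (measurable_upd (v := v))).
apply/prod_measurable_funP; split => /=; last exact: measurable_fst.
exact: measurable_cst.
Qed.

Lemma iter_int_mid s1 v s2 F : v \notin s1 -> measurable_fun setT F ->
  (forall x, 0 <= F x) -> iter_int (s1 ++ v :: s2) F = iter_int (v :: s1 ++ s2) F.
Proof.
elim: s1 F => //= w s1 IH F; rewrite inE negb_or => /andP[vw vs1] mF F0.
rewrite IH//=; first by rewrite integrate_outC.
- exact: measurable_integrate_out.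
- exact: integrate_out_ge0.
Qed.

Lemma iter_int_perm s1 s2 F : uniq s1 -> perm_eq s1 s2 -> measurable_fun setT F ->
  (forall x, 0 <= F x) -> iter_int s1 F = iter_int s2 F.
Proof.
elim: s1 s2 F => [|v s1 IH] s2 F us1 s12 mF F0.
  by move: s12; rewrite perm_sym => /perm_nilP ->.
have vs2 : v \in s2 by rewrite -(perm_mem s12) mem_head.
have us2 : uniq s2 by rewrite -(perm_uniq s12).
case/splitPr: vs2 us2 s12 => p q; rewrite uniq_catC /= => /andP[vqp _] s12.
move: vqp; rewrite mem_cat negb_or => /andP[_ vp].
rewrite iter_int_mid//= (IH (p ++ q))//.
- by case/andP: us1.
- by rewrite -(perm_cons v) (perm_trans s12)// perm_catC/= perm_cons perm_catC.
- exact: measurable_integrate_out.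
- exact: integrate_out_ge0.
Qed.

(** Boxes exhaust the space: their sides are exhausting sets of finite measure for [v] in [s] and
    the full space elsewhere, where the measure is a Dirac mass. *)
Lemma sigma_finite_prodmeas_seq s x : uniq s ->
  sigma_finite setT (prodmeas_seq mu s x).
Proof.
move=> us.
have HB' v : {B : nat -> set (X v) |
    [/\ setT = \bigcup_i B i, nondecreasing_seq B &
       forall i, measurable (B i) /\ mu v (B i) < +oo]}.
  exact/cid/sigma_finiteP/sigma_finiteT.
pose B v := sval (HB' v).
have HB v : [/\ setT = \bigcup_i B v i, nondecreasing_seq (B v) &
    forall i, measurable (B v i) /\ mu v (B v i) < +oo] := svalP (HB' v).
pose C n v : set (X v) := if v \in s then B v n else setT.
have mC n v : measurable (C n v).
  by rewrite /C; case: ifP => // _; case: (HB v) => _ _ /(_ n)[].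
exists (fun n => [set z : prodspace X | forall v, C n v (z v)]).
  apply/seteqP; split=> // z _.
  have kP v : {n | B v n (z v)}.
    apply: cid; have : [set: X v] (z v) by [].
    by case: (HB v) => BT _ _; rewrite BT => -[n _ Bn]; exists n.
  pose k v := sval (kP v).
  (* Finitely many coordinates and increasing exhaustions: the largest index serves all of them. *)
  exists (\max_(v : V) k v)%N => // v; rewrite /C; case: ifP => // _.
  case: (HB v) => _ ndB _; have /subsetPset := ndB _ _ (leq_bigmax v : (k v <= _)%N).
  by apply; exact: svalP (kP v).
move=> n; split; first exact: measurable_box.
rewrite prodmeas_seq_box//; last by move=> v /negPf vs; rewrite /C vs.
rewrite big_seq -ge0_fin_numE; last by apply: prode_ge0 => v _.
apply: prode_fin_num => v vs; rewrite ge0_fin_numE// /C vs.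
by case: (HB v) => _ _ /(_ n)[].
Qed.

Lemma integral_prodmeas_seq s x F : uniq s -> measurable_fun setT F ->
  (forall x, 0 <= F x) -> \int[prodmeas_seq mu s x]_z F z = iter_int s F x.
Proof.
elim: s F => [|v s IH] F /=; first by move=> _ mF F0; rewrite integral_dirac// diracT mul1e.
move=> /andP[vs us] mF F0.
rewrite ge0_integral_pushforward//; last exact: measurable_upd.
rewrite preimage_setT.
rewrite tonelli_sigma_finite;
  [|exact: sigma_finite_prodmeas_seq|exact: measurable_comp_upd|by move=> p; exact: F0].
by rewrite -IH//; [exact: measurable_integrate_out|exact: integrate_out_ge0].
Qed.

(** Version of [depends_only_on] for any codomain, so that it also covers extended-real
    integrals. *)
Definition on_coords (T : Type) (h : {set V}) (f : prodspace X -> T) :=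
  forall x y, (forall v, v \in h -> x v = y v) -> f x = f y.

Lemma upd_agree (h : {set V}) v x y (t : X v) :
  (forall w, w \in (h :\ v)%SET -> x w = y w) ->
  forall w, w \in h -> upd (x, t) w = upd (y, t) w.
Proof.
move=> xy w wh; case: (eqVneq v w) => [<-|vw]; first by rewrite !upd_in.
by rewrite !upd_out//; apply: xy; rewrite !inE eq_sym vw.
Qed.

Lemma on_coords_integrate_out (h : {set V}) v F :
  on_coords h F -> on_coords (h :\ v)%SET (integrate_out v F).
Proof.
move=> hF x y xy; apply: eq_integral => t _.
exact/hF/upd_agree.
Qed.

Lemma on_coords_sub (T : Type) (h k : {set V}) (f : prodspace X -> T) :
  h \subset k -> on_coords h f -> on_coords k f.
Proof. by move=> /fintype.subsetP hk hf x y xy; apply: hf => v /hk; exact: xy. Qed.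

Lemma on_coords_iter_int (h : {set V}) s F :
  on_coords h F -> on_coords (h :\: [set v in s])%SET (iter_int s F).
Proof.
elim: s h F => [|v s IH] h F hF /=.
  by apply: on_coords_sub hF; apply/fintype.subsetP => v; rewrite !inE.
have := IH _ _ (on_coords_integrate_out (v := v) hF); apply: on_coords_sub.
apply/fintype.subsetP => w; rewrite !inE negb_or.
by case/andP => -> /andP[-> ->].
Qed.

Lemma integrate_out_scale (h : {set V}) v F H : on_coords h F -> v \notin h ->
  measurable_fun setT H -> (forall x, 0 <= F x) -> (forall x, 0 <= H x) ->
  integrate_out v (fun x => F x * H x) = (fun x => F x * integrate_out v H x).
Proof.
move=> hF vh mH F0 H0; apply/funext => y; rewrite /integrate_out.
rewrite -ge0_integralZl//; last exact: measurable_upd_section.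
apply: eq_integral => t _; congr (_ * _); apply: hF => w wh.
by rewrite upd_out//; apply: contraNneq vh => ->.
Qed.

Lemma iter_int_scale (h : {set V}) s F H : on_coords h F ->
  {in s, forall v, v \notin h} ->
  measurable_fun setT H -> (forall x, 0 <= F x) -> (forall x, 0 <= H x) ->
  iter_int s (fun x => F x * H x) = (fun x => F x * iter_int s H x).
Proof.
move=> hF; elim: s H => //= v s IH H hs mH F0 H0.
have vh : v \notin h by apply: hs; exact: mem_head.
rewrite (integrate_out_scale hF vh)// IH//.
- by move=> w ws; apply: hs; rewrite inE ws orbT.
- exact: measurable_integrate_out.
- exact: integrate_out_ge0.
Qed.

(** * Freezing the intervened coordinates *)

Section Substitution.
Variables (A : {set V}) (a0 : prodspace X).

Definition subst x : prodspace X := fun v => if v \in A then a0 v else x v.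

Lemma substE x : (forall a, a \in A -> x a = a0 a) -> subst x = x.
Proof.
move=> xa; apply: functional_extensionality_dep => v; rewrite /subst.
by case: ifPn => // /xa ->.
Qed.

Lemma subst_in x a : a \in A -> subst x a = a0 a.
Proof. by rewrite /subst => ->. Qed.

Lemma substK x : subst (subst x) = subst x.
Proof. by apply: substE => a; exact: subst_in. Qed.

Lemma subst_upd v x (t : X v) : v \notin A -> subst (upd (x, t)) = upd (subst x, t).
Proof.
move=> vA; apply: functional_extensionality_dep => w.
case: (eqVneq v w) => [<-|vw]; first by rewrite /subst (negPf vA) !upd_in.
by rewrite upd_out// /subst; case: ifP => // _; rewrite upd_out.
Qed.

Lemma on_coords_subst (T : Type) (h : {set V}) (f : prodspace X -> T) :
  on_coords h f -> on_coords (h :\: A)%SET (f \o subst).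
Proof.
move=> hf x y xy; apply: hf => v vh; rewrite /subst; case: ifPn => // vA.
by apply: xy; rewrite inE vA.
Qed.

Lemma measurable_subst : measurable_fun setT subst.
Proof.
apply: measurability => // _ [_ [w [B mB ->]] <-]; rewrite setTI.
have [wA|wA] := boolP (w \in A).
  have [aB|aB] := pselect (B (a0 w)).
    rewrite [X in measurable X](_ : _ = setT)//.
    by apply/seteqP; split=> // x _; rewrite /= subst_in.
  rewrite [X in measurable X](_ : _ = set0)//.
  by apply/seteqP; split=> // x; rewrite /= subst_in.
rewrite [X in measurable X](_ : _ = (fun x : prodspace X => x w) @^-1` B).
  by rewrite -[X in measurable X]setTI; exact: measurable_coord.
by apply/seteqP; split=> x; rewrite /= /subst (negPf wA).
Qed.

Lemma iter_int_subst s F : {in s, forall v, v \notin A} ->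
  iter_int s (F \o subst) = iter_int s F \o subst.
Proof.
elim: s F => //= v s IH F sA.
have vA : v \notin A by apply: sA; exact: mem_head.
rewrite -IH; last by move=> w ws; apply: sA; rewrite inE ws orbT.
congr iter_int; apply/funext => y; apply: eq_integral => t _.
by rewrite /= subst_upd.
Qed.

Lemma integral_base_measure F : measurable_fun setT F -> (forall x, 0 <= F x) ->
  \int[base_measure mu A a0]_x F x = iter_int (enum (~: A)%SET) F a0.
Proof. by move=> mF F0; exact: integral_prodmeas_seq (enum_uniq _) mF F0. Qed.

(** Only coordinates outside [A] are integrated, which commutes with freezing, and the result is
    evaluated at [a0], a fixed point of [subst]. *)
Lemma integral_base_subst F : measurable_fun setT F -> (forall x, 0 <= F x) ->
  \int[base_measure mu A a0]_x F (subst x) = \int[base_measure mu A a0]_x F x.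
Proof.
move=> mF F0; rewrite !integral_base_measure//; last first.
  by apply: measurableT_comp => //; exact: measurable_subst.
rewrite (iter_int_subst F) /=; first by rewrite substE.
by move=> v; rewrite mem_enum inE.
Qed.

(** The preimage of a null set under [subst] is null, by [integral_base_subst] applied to its
    indicator. *)
Lemma ae_base_subst (P : prodspace X -> Prop) :
  {ae base_measure mu A a0, forall x, P x} ->
  {ae base_measure mu A a0, forall x, P (subst x)}.
Proof.
move=> [N [mN N0 PN]].
have mN' : measurable (subst @^-1` N).
  by rewrite -[X in measurable X]setTI; exact: measurable_subst.
exists (subst @^-1` N); split => //; last by move=> x /= nP; exact: PN.
transitivity (\int[base_measure mu A a0]_x (\1_N (subst x) : R)%:E).
  rewrite -[X in _ X = _]setIT -integral_indic//.
transitivity (\int[base_measure mu A a0]_x (\1_N x : R)%:E).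
  apply: (integral_base_subst (F := fun x => (\1_N x : R)%:E)) => //.
  by apply/measurable_EFinP.
by rewrite integral_indic// setIT.
Qed.
End Substitution.
End IteratedIntegral.

(** * Conditional factors *)

Section Normalization.
Context {R : realType} {I : finType}.
Implicit Types (D : pred I) (z : I -> \bar R) (p : I -> R) (c : R).

(** In both cases [fine] sends the product to 0, so a factor normalized by it vanishes. *)
Lemma prode_pinfty D z i : (forall j, D j -> (0 <= z j)%E) -> D i -> z i = +oo%E ->
  (\prod_(j | D j) z j = 0 \/ \prod_(j | D j) z j = +oo)%E.
Proof.
move=> z0 Di zi; rewrite (bigD1 i)//= zi.
have : (0 <= \prod_(j | D j && (j != i)) z j)%E.
  by apply: prode_ge0 => j /andP[/z0].
rewrite le_eqVlt => /predU1P[<-|]; first by left; rewrite mule0.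
by move=> p0; right; rewrite gt0_mulye.
Qed.

Lemma fin_or_pinfty D z : (forall j, D j -> (0 <= z j)%E) ->
  (forall j, D j -> z j \is a fin_num) \/ exists2 i, D i & z i = +oo%E.
Proof.
move=> z0; have [/existsP[i /andP[Di /eqP zi]]|] := boolP [exists i, D i && (z i == +oo%E)].
  by right; exists i.
rewrite negb_exists => /forallP H; left => j Dj.
by rewrite ge0_fin_numE ?z0// ltey; move: (H j); rewrite Dj.
Qed.

Lemma prod_normalized_fin D z p : (forall j, D j -> z j \is a fin_num) ->
  \prod_(j | D j) ((fine (z j))^-1 * p j) =
  (fine (\prod_(j | D j) z j)%E)^-1 * \prod_(j | D j) p j.
Proof.
move=> zf; rewrite big_split/= prodfV; congr (_^-1 * _).
rewrite (eq_bigr (fun j => (fine (z j))%:E)) => [|j Dj]; last by rewrite fineK ?zf.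
by rewrite prodEFin.
Qed.

(* Only an inequality: where the total normalizer is 0 or [+oo], the left-hand
   side is 0 by the conventions 0^-1 = 0 and fine +oo = 0. *)
Lemma normalized_le_prod D z p c : (forall j, D j -> (0 <= z j)%E) ->
  (forall j, D j -> 0 <= p j) -> 
  (fine (c%:E * \prod_(j | D j) z j)%E)^-1 * (c * \prod_(j | D j) p j) <=
  \prod_(j | D j) ((fine (z j))^-1 * p j).
Proof.
move=> z0 p0.
have r0 : 0 <= \prod_(j | D j) ((fine (z j))^-1 * p j).
  apply: prodr_ge0 => j Dj; apply: mulr_ge0; last exact: p0.
  by rewrite invr_ge0 fine_ge0// z0.
have [->|c0] := eqVneq c 0; first by rewrite mul0r mulr0.
case: (fin_or_pinfty z0) => [zf|[i Di zi]]; last first.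
  suff -> : fine (c%:E * \prod_(j | D j) z j)%E = 0 by rewrite invr0 mul0r.
  case: (prode_pinfty z0 Di zi) => ->; first by rewrite mule0.
  by rewrite mulry; case: sgrP => _; rewrite ?mul0e ?mul1e ?mulN1e.
rewrite fineM//; last exact: prode_fin_num.
by rewrite prod_normalized_fin//= invfM mulrACA mulVf// mul1r.
Qed.

(** If all [z j] are finite, both sides agree, zeros included, since inversion is multiplicative
    with 0^-1 = 0. An infinite [z i] makes the left-hand side 0. *)
Lemma prod_le_normalized D z p : (forall j, D j -> (0 <= z j)%E) ->
  (forall j, D j -> 0 <= p j) ->
  \prod_(j | D j) ((fine (z j))^-1 * p j) <=
  (fine (\prod_(j | D j) z j)%E)^-1 * \prod_(j | D j) p j.
Proof.
move=> z0 p0; case: (fin_or_pinfty z0) => [zf|[i Di zi]].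
  by rewrite prod_normalized_fin.
rewrite (bigD1 i)//= zi /= invr0 !mul0r; apply: mulr_ge0; last exact: prodr_ge0.
by rewrite invr_ge0 fine_ge0// prode_ge0.
Qed.

End Normalization.

Section Factors.
Context {R : realType} {V : finType} {d : V -> measure_display}.
Context {X : forall v, measurableType (d v)}.
Variable mu : forall v, {sigma_finite_measure set (X v) -> \bar R}.
Implicit Types (x y : prodspace X).

Lemma measurable_prod_cond (I : finType) (D : pred I) (F : I -> prodspace X -> R) :
  (forall i, D i -> measurable_fun setT (F i)) ->
  measurable_fun setT (fun x => \prod_(i | D i) F i x).
Proof.
move=> mF; rewrite [X in measurable_fun _ X](_ : _ =
    fun x => \prod_(i <- [seq i <- index_enum I | D i]) F i x).
  by apply: measurable_prod => i; rewrite mem_filter => /andP[/mF].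
by apply/funext => x; rewrite big_filter.
Qed.

Lemma on_coords_prod (I : finType) (D : pred I) (h : {set V}) (F : I -> prodspace X -> R) :
  (forall i, D i -> on_coords h (F i)) ->
  on_coords h (fun x => \prod_(i | D i) F i x).
Proof. by move=> hF x y xy; apply: eq_bigr => i /hF; exact. Qed.

Lemma measurable_inv_ge0 (f : prodspace X -> R) : (forall x, 0 <= f x) ->
  measurable_fun setT f -> measurable_fun setT (fun x => (f x)^-1).
Proof.
move=> f0 mf.
(* The inverse and the real power -1 agree on nonnegative numbers, 0 included. *)
rewrite [X in measurable_fun _ X](_ : _ = (@powR R)^~ (-1) \o f).
  by apply: measurableT_comp => //; exact: measurable_powR.
by apply/funext => x /=; rewrite powR_inv1.
Qed.

Lemma iter_int_setU (S T : {set V}) (F : prodspace X -> \bar R) :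
  (forall v, v \in S -> v \notin T) -> measurable_fun setT F ->
  (forall x, 0 <= F x)%E ->
  iter_int mu (enum (S :|: T)%SET) F = iter_int mu (enum T) (iter_int mu (enum S) F).
Proof.
move=> ST mF F0; rewrite -iter_int_cat; apply: iter_int_perm => //.
  exact: enum_uniq.
apply: uniq_perm; first exact: enum_uniq.
  rewrite cat_uniq !enum_uniq andbT/=; apply/hasPn => v.
  by rewrite !mem_enum => vT; apply: contraL vT => /ST.
by move=> v; rewrite mem_cat !mem_enum inE.
Qed.

Lemma iter_int_set0 (F : prodspace X -> \bar R) : iter_int mu (enum (@finset.set0 V)) F = F.
Proof. by rewrite (_ : enum _ = [::])//; apply/size0nil; rewrite -cardE cards0. Qed.

(** Each [F i] is constant in the variables [B j] of the other factors, so the integral of the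
    product splits. Measurability and dependence of the product are part of the conclusion because
    the induction uses them. *)
Lemma iter_int_prod_seq (I : eqType) (r : seq I) (B h : I -> {set V})
    (F : I -> prodspace X -> \bar R) : uniq r ->
  (forall i, i \in r -> measurable_fun setT (F i)) ->
  (forall i x, i \in r -> (0 <= F i x)%E) ->
  (forall i, i \in r -> on_coords (h i) (F i)) ->
  (forall i, i \in r -> B i \subset h i) ->
  (forall i j v, i \in r -> j \in r -> i != j -> v \in h i -> v \notin B j) ->
  [/\ measurable_fun setT (fun x => \prod_(i <- r) F i x)%E,
     on_coords (\bigcup_(i <- r) h i)%SET (fun x => \prod_(i <- r) F i x)%E &
  iter_int mu (enum (\bigcup_(i <- r) B i)%SET) (fun x => \prod_(i <- r) F i x)%E =
  (fun x => \prod_(i <- r) iter_int mu (enum (B i)) (F i) x)%E].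
Proof.
elim: r => [|i r IH] /=.
  move=> _ _ _ _ _ _.
  have E : (fun x => \prod_(i <- [::]) F i x)%E = cst 1%E.
    by apply/funext => x; rewrite big_nil.
  rewrite E big_nil; split => //; rewrite big_nil iter_int_set0.
  by apply/funext => x; rewrite big_nil.
move=> /andP[ir ur] mF F0 hF Bh hB.
have inr j : j \in r -> j \in i :: r by move=> jr; rewrite inE jr orbT.
have ii := mem_head i r.
have [|||||mQ lQ iQ] := IH ur.
- by move=> j /inr; exact: mF.
- by move=> j x /inr; exact: F0.
- by move=> j /inr; exact: hF.
- by move=> j /inr; exact: Bh.
- by move=> j k v /inr jr /inr; exact: hB.
have Q0 x : (0 <= \prod_(i <- r) F i x)%E.
  by rewrite big_seq; apply: prode_ge0 => j /inr; exact: F0.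
have nir j : j \in r -> i != j by move=> jr; apply: contraNneq ir => ->.
have E : (fun x => \prod_(j <- i :: r) F j x)%E =
         (fun x => (\prod_(j <- r) F j x) * F i x)%E.
  by apply/funext => x; rewrite big_cons muleC.
have notB v : v \in h i -> v \notin (\bigcup_(j <- r) B j)%SET.
  move=> vh; rewrite big_seq; elim/big_ind: _ => [|S T vS vT|j jr].
  - by rewrite inE.
  - by rewrite inE negb_or vS vT.
  - by apply: hB vh => //; [exact: inr|exact: nir].
have noth v : v \in B i -> v \notin (\bigcup_(j <- r) h j)%SET.
  move=> vB; rewrite big_seq; elim/big_ind: _ => [|S T vS vT|j jr].
  - by rewrite inE.
  - by rewrite inE negb_or vS vT.
  - apply: contraL vB => vh; apply: (hB j i) => //; first exact: inr.
    by rewrite eq_sym nir.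
rewrite E; split.
- by apply: emeasurable_funM => //; exact: mF.
- rewrite big_cons => x y xy; congr (_ * _)%E.
    by apply: lQ => v vh; apply: xy; rewrite inE vh orbT.
  by apply: (hF _ ii) => v vh; apply: xy; rewrite inE vh.
(* Over [B i] the product of the remaining factors comes out of the integral; over the remaining
   variables the integral of [F i] comes out in turn. *)
rewrite big_cons iter_int_setU; first last.
- by move=> x; apply: mule_ge0 => //; exact: F0.
- by apply: emeasurable_funM => //; exact: mF.
- by move=> v vB; apply: notB; apply: fintype.subsetP vB; exact: Bh.
rewrite (iter_int_scale mu lQ)//; first last.
- by move=> x; exact: F0.
- exact: mF.
- by move=> v; rewrite mem_enum; exact: noth.
rewrite (eq_iter_int mu _ (H := fun x =>
   iter_int mu (enum (B i)) (F i) x * \prod_(j <- r) F j x)%E); last first.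
  by move=> x; rewrite muleC.
rewrite (@iter_int_scale _ _ _ _ _ (h i))//.
- by apply/funext => x; rewrite iQ big_cons.
- by apply: on_coords_sub (on_coords_iter_int mu (s := enum (B i)) (hF _ ii)); exact: subsetDl.
- by move=> v; rewrite mem_enum; apply: contraL; exact: notB.
- by move=> x; apply: iter_int_ge0 => y; exact: F0.
Qed.

Lemma iter_int_prod (I : finType) (D : {set I}) (B h : I -> {set V})
    (F : I -> prodspace X -> \bar R) :
  (forall i, i \in D -> measurable_fun setT (F i)) ->
  (forall i x, i \in D -> (0 <= F i x)%E) ->
  (forall i, i \in D -> on_coords (h i) (F i)) ->
  (forall i, i \in D -> B i \subset h i) ->
  (forall i j v, i \in D -> j \in D -> i != j -> v \in h i -> v \notin B j) ->
  measurable_fun setT (fun x => \prod_(i in D) F i x)%E /\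
  iter_int mu (enum (\bigcup_(i in D) B i)%SET) (fun x => \prod_(i in D) F i x)%E =
  (fun x => \prod_(i in D) iter_int mu (enum (B i)) (F i) x)%E.
Proof.
move=> mF F0 hF Bh hB.
have [|||||mQ _ iQ] := @iter_int_prod_seq _ (enum D) B h F (enum_uniq _).
- by move=> i; rewrite mem_enum; exact: mF.
- by move=> i x; rewrite mem_enum; exact: F0.
- by move=> i; rewrite mem_enum; exact: hF.
- by move=> i; rewrite mem_enum; exact: Bh.
- by move=> i j v; rewrite !mem_enum; exact: hB.
have E : (fun x => \prod_(i in D) F i x)%E = (fun x => \prod_(i <- enum D) F i x)%E.
  by apply/funext => x; rewrite big_enum.
rewrite E -big_enum; split => //; rewrite iQ.
by apply/funext => x; rewrite big_enum.
Qed.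

(** * Total mass of a product of conditional factors *)

Section ConditionalFactors.
Variables (K : chain_graph V) (A : {set V}).
Variable psi : {set V} -> {set V} -> prodspace X -> R.
Hypothesis psiP : forall t h, t \in chain_components K ->
  h \in moral_cliques K (t :|: pa_set K t)%SET -> is_potential h (psi t h).
Implicit Types (t : {set V}).

Local Notation P t := (potential_prod K t (psi t)).
Local Notation Z t := (partition_fun mu K A t (psi t)).
Local Notation k t := (conditional_factor mu K A t (psi t)).

Lemma potential_prod_ge0 t x : t \in chain_components K -> 0 <= P t x.
Proof. by move=> tK; apply: prodr_ge0 => h /(psiP tK)[_ + _]; exact. Qed.

Lemma measurable_potential_prod t : t \in chain_components K ->
  measurable_fun setT (P t).
Proof. by move=> tK; apply: measurable_prod_cond => h /(psiP tK)[]. Qed.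

Lemma on_coords_potential_prod t : t \in chain_components K ->
  on_coords (t :|: pa_set K t)%SET (P t).
Proof.
move=> tK; apply: on_coords_prod => h hK; have [_ _ dh] := psiP tK hK.
exact: on_coords_sub (moral_clique_sub hK) dh.
Qed.

Lemma partition_funE t : t \in chain_components K ->
  Z t = iter_int mu (enum (t :\: A)%SET) (EFin \o P t).
Proof.
move=> tK; apply/funext => x; apply: integral_prodmeas_seq (enum_uniq _) _ _.
  by apply/measurable_EFinP; exact: measurable_potential_prod.
by move=> y; rewrite /= lee_fin potential_prod_ge0.
Qed.

Lemma partition_fun_ge0 t x : t \in chain_components K -> (0 <= Z t x)%E.
Proof.
move=> tK; apply: integral_ge0 => y _; by rewrite lee_fin potential_prod_ge0.
Qed.

Lemma conditional_factor_ge0 t x : t \in chain_components K -> 0 <= k t x.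
Proof.
move=> tK; apply: mulr_ge0; last exact: potential_prod_ge0.
by rewrite invr_ge0 fine_ge0// partition_fun_ge0.
Qed.

Lemma measurable_partition_fun t : t \in chain_components K ->
  measurable_fun setT (Z t).
Proof.
move=> tK; rewrite partition_funE//; apply: measurable_iter_int.
  by apply/measurable_EFinP; exact: measurable_potential_prod.
by move=> y; rewrite /= lee_fin potential_prod_ge0.
Qed.

Lemma measurable_inv_partition t : t \in chain_components K ->
  measurable_fun setT (fun x => (fine (Z t x))^-1).
Proof.
move=> tK; apply: measurable_inv_ge0; first by move=> x; rewrite fine_ge0// partition_fun_ge0.
apply: measurableT_comp; first exact: fine_measurable.
exact: measurable_partition_fun.
Qed.

Lemma measurable_conditional_factor t : t \in chain_components K ->
  measurable_fun setT (k t).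
Proof.
move=> tK; apply: measurable_funM; first exact: measurable_inv_partition.
exact: measurable_potential_prod.
Qed.

Lemma on_coords_partition_fun t : t \in chain_components K ->
  on_coords ((t :|: pa_set K t) :\: (t :\: A))%SET (Z t).
Proof.
move=> tK; rewrite partition_funE//.
have : on_coords (t :|: pa_set K t)%SET (EFin \o P t).
  by move=> x y xy /=; rewrite (on_coords_potential_prod tK xy).
move=> /(on_coords_iter_int mu (s := enum (t :\: A)%SET)).
apply: on_coords_sub; apply: finset.setDS; apply/fintype.subsetP => v.
by move=> vt; rewrite inE mem_enum.
Qed.

Lemma on_coords_conditional_factor t : t \in chain_components K ->
  on_coords (t :|: pa_set K t)%SET (k t).
Proof.
move=> tK x y xy; congr (_^-1 * _); last exact: on_coords_potential_prod xy.
congr fine; apply: on_coords_partition_fun => // v.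
by rewrite finset.in_setD => /andP[_]; exact: xy.
Qed.

(** The normalizer does not depend on the integrated coordinates. So the integral is 1 where the
    normalizer is positive and finite, and 0 elsewhere by the conventions on inverse and [fine]. *)
Lemma iter_int_conditional_factor t x : t \in chain_components K ->
  (iter_int mu (enum (t :\: A)%SET) (EFin \o k t) x <= 1)%E.
Proof.
move=> tK.
rewrite (eq_iter_int mu _ (H := fun x => ((fine (Z t x))^-1)%:E * (EFin \o P t) x)%E); last first.
  by move=> y; rewrite /= -EFinM.
rewrite (@iter_int_scale _ _ _ _ _ ((t :|: pa_set K t) :\: (t :\: A))%SET).
- rewrite -partition_funE//; have := partition_fun_ge0 x tK.
  case: (Z t x) => [r r0|_|//]; last by rewrite /= invr0 mul0e.
  rewrite /= -EFinM lee_fin; have [->|r_neq0] := eqVneq r 0.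
    by rewrite mulr0.
  by rewrite mulVf.
- by move=> y z yz; congr ((fine _)^-1)%:E; exact: on_coords_partition_fun.
- by move=> v; rewrite mem_enum => vt; rewrite finset.in_setD vt.
- by apply/measurable_EFinP; exact: measurable_potential_prod.
- by move=> y; rewrite lee_fin invr_ge0 fine_ge0// partition_fun_ge0.
- by move=> y; rewrite /= lee_fin potential_prod_ge0.
Qed.

(* Integrate out first a component of D without children in D: the other
   factors do not depend on it. *)
Lemma iter_int_factors_le1 (D : {set {set V}}) x : D \subset chain_components K ->
  (iter_int mu (enum ((\bigcup_(t in D) t) :\: A)%SET)
    (fun x => (\prod_(t in D) k t x)%:E) x <= 1)%E.
Proof.
move: {2}#|D| (erefl #|D|) => n; elim: n D => [|n IH] D cD DK.
  move/eqP: cD; rewrite cards_eq0 => /eqP ->.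
  by rewrite big_set0 finset.set0D iter_int_set0 big_set0.
have D0 : D != finset.set0 by rewrite -card_gt0 cD.
have [t0 t0D term] := exists_terminal_component DK D0.
have DK' := fintype.subsetP DK; have t0K := DK' _ t0D.
pose E := (D :\ t0)%SET.
have EK : E \subset chain_components K by apply: fintype.subset_trans DK; exact: subD1set.
have EK' := fintype.subsetP EK.
have ED t : t \in E -> t \in D /\ t != t0 by rewrite !inE => /andP[-> ->].
rewrite (big_setD1 t0)//= finset.setDUl iter_int_setU; first last.
- by move=> y; rewrite lee_fin; apply: prodr_ge0 => t /DK'; exact: conditional_factor_ge0.
- apply/measurable_EFinP; apply: measurable_prod_cond => t /DK'.
  exact: measurable_conditional_factor.
- move=> v; rewrite !finset.in_setD => /andP[vA vt0]; rewrite vA /=.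
  apply/bigcupP => -[t tE vt]; case: (ED _ tE) => tD.
  by rewrite (chain_component_disjoint (DK' _ tD) t0K vt vt0) eqxx.
have mQ : measurable_fun setT (fun x => \prod_(t in E) k t x).
  by apply: measurable_prod_cond => t /EK'; exact: measurable_conditional_factor.
have Q0 y : 0 <= \prod_(t in E) k t y.
  by apply: prodr_ge0 => t /EK'; exact: conditional_factor_ge0.
rewrite (eq_iter_int mu (enum (t0 :\: A)%SET) (H := fun x =>
  (\prod_(t in E) k t x)%:E * (EFin \o k t0) x)%E); last first.
  by move=> y; rewrite (big_setD1 t0)//= mulrC EFinM.
rewrite (@iter_int_scale _ _ _ _ _ (\bigcup_(t in E) (t :|: pa_set K t))%SET); first last.
- by move=> y; rewrite lee_fin conditional_factor_ge0.
- by move=> y; rewrite lee_fin.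
- by apply/measurable_EFinP; exact: measurable_conditional_factor.
- move=> v; rewrite mem_enum finset.in_setD => /andP[_ vt0].
  apply/bigcupP => -[t tE]; have [tD tt0] := ED _ tE.
  case/setUP => [vt|vp].
    by move/eqP: tt0; apply; exact: (chain_component_disjoint (DK' _ tD) t0K vt vt0).
  by move: (term _ tD) => /disjointFr/(_ vt0); rewrite vp.
- move=> y z yz; congr EFin; apply: eq_bigr => t tE.
  apply: on_coords_conditional_factor; first exact: EK'.
  by move=> v vt; apply: yz; apply/bigcupP; exists t.
apply: le_trans (IH E _ EK); last by move: cD; rewrite (cardsD1 t0) t0D => -[].
have mk : measurable_fun setT (iter_int mu (enum (t0 :\: A)%SET) (EFin \o k t0)).
  apply: measurable_iter_int; last by move=> y; rewrite lee_fin conditional_factor_ge0.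
  by apply/measurable_EFinP; exact: measurable_conditional_factor.
have k0 y : (0 <= iter_int mu (enum (t0 :\: A)%SET) (EFin \o k t0) y)%E.
  by apply: iter_int_ge0 => z; rewrite lee_fin conditional_factor_ge0.
(* The inner integral over [t0] is at most 1, so dropping it can only increase the integrand. *)
apply: le_iter_int.
- by apply: emeasurable_funM => //; exact/measurable_EFinP.
- exact/measurable_EFinP.
- by move=> y; apply: mule_ge0 => //; rewrite lee_fin.
- move=> y; rewrite -[leRHS]mule1; apply: lee_wpmul2l; first by rewrite lee_fin.
  exact: iter_int_conditional_factor.
Qed.

Lemma integral_factors_le1 (a0 : prodspace X) :
  (\int[base_measure mu A a0]_x (\prod_(t in chain_components K) k t x)%:E <= 1)%E.
Proof.
rewrite integral_base_measure; first last.
- by move=> y; rewrite lee_fin; apply: prodr_ge0 => t; exact: conditional_factor_ge0.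
- apply/measurable_EFinP; apply: measurable_prod_cond => t.
  exact: measurable_conditional_factor.
have := iter_int_factors_le1 a0 (subxx (chain_components K)).
rewrite (_ : \bigcup_(t in _) t = finset.setT)%SET ?finset.setTD//.
apply/setP => v; rewrite inE; apply/bigcupP; exists (component K v).
  exact: component_chain.
exact: mem_component.
Qed.

End ConditionalFactors.
End Factors.

(** * Comparison of the two factorizations *)

Section Comparison.
Context {R : realType} {V : finType} {d : V -> measure_display}.
Context {X : forall v, measurableType (d v)}.
Variable mu : forall v, {sigma_finite_measure set (X v) -> \bar R}.
Variables (A : {set V}) (a0 : prodspace X).
Implicit Types (x y : prodspace X) (f g : prodspace X -> R).
Local Notation base := (base_measure mu A a0).
Local Notation subst := (subst A a0).

(* [subst] is needed because [x_A = a0] need not define a measurable set. *)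
Lemma density_dominated f h g : is_density mu A a0 f ->
  measurable_fun setT g -> (forall x, 0 <= g x) ->
  (\int[base]_x (g x)%:E <= 1)%E ->
  {ae base, forall x, (forall a, a \in A -> x a = a0 a) -> f x = h x} ->
  (forall x, h (subst x) <= g (subst x)) ->
  {ae base, forall x, (forall a, a \in A -> x a = a0 a) -> f x = g x}.
Proof.
move=> [mf f0 f1] mg g0 g1 fh hg.
have ms := measurable_subst A a0.
(* The maximum makes [G x - F x] nonnegative at every point, while [G] still agrees almost
   everywhere with [g] after freezing. *)
pose F x := (f (subst x))%:E; pose G x := (Num.max (f (subst x)) (g (subst x)))%:E.
have mfs : measurable_fun setT (f \o subst) by exact: measurableT_comp.
have mgs : measurable_fun setT (g \o subst) by exact: measurableT_comp.
have mF : measurable_fun setT F by exact/measurable_EFinP.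
have mG : measurable_fun setT G.
  by apply/measurable_EFinP; exact: measurable_maxr.
have F0 x : (0 <= F x)%E by rewrite lee_fin.
have FG x : (F x <= G x)%E by rewrite lee_fin le_max lexx.
have G0 x : (0 <= G x)%E by exact: le_trans (FG x).
have intF : (\int[base]_x F x = 1)%E.
  rewrite (integral_base_subst mu A a0 (F := EFin \o f))//.
  by apply/measurable_EFinP.
have fgs : {ae base, forall x, f (subst x) <= g (subst x)}.
  apply: filterS (ae_base_subst fh) => x /= ->; first exact: hg.
  by move=> a; exact: subst_in.
have intG : (\int[base]_x G x <= 1)%E.
  apply: le_trans g1; rewrite -(integral_base_subst mu A a0 (F := EFin \o g))//;
    last exact/measurable_EFinP.
  rewrite (ge0_ae_eq_integral (g := fun x => (g (subst x))%:E))//.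
  - by apply/measurable_EFinP.
  - by move=> x _; rewrite lee_fin.
  - by apply: filterS fgs => x fgx _; rewrite /G max_r.
have iF : base.-integrable setT F.
  by apply/integrableP; split => //; under eq_integral do rewrite gee0_abs//; rewrite intF ltry.
have iG : base.-integrable setT G.
  apply/integrableP; split => //; under eq_integral do rewrite gee0_abs//.
  by rewrite (le_lt_trans intG)// ltry.
(* A nonnegative function whose integral is at most 1 - 1 = 0 vanishes almost everywhere. *)
have : ae_eq base setT (fun x => G x - F x)%E (cst 0%E).
  apply/ae_eq_integral_abs => //; first exact: emeasurable_funB.
  under eq_integral do rewrite gee0_abs ?sube_ge0//.
  apply/eqP; rewrite eq_le; apply/andP; split; last first.
    by apply: integral_ge0 => x _; rewrite sube_ge0.
  by rewrite integralB// intF sube_le0.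
move=> GF; apply: filterS2 fgs GF => x fgx /(_ I) /= + xA.
rewrite (substE xA) in fgx *; rewrite /F /G (substE xA) max_r//.
by rewrite -EFinB => -[] /eqP; rewrite subr_eq0 => /eqP.
Qed.

Variable G : chain_graph V.
Let G' := redirect G A.
Variables psi phi : {set V} -> {set V} -> prodspace X -> R.
Hypothesis psiP : forall t h, t \in chain_components G ->
  h \in moral_cliques G (t :|: pa_set G t)%SET -> is_potential h (psi t h).
Hypothesis phiP : forall t h, t \in chain_components G' ->
  h \in moral_cliques G' (t :|: pa_set G' t)%SET -> is_potential h (phi t h).
Implicit Types (t s : {set V}).

Local Notation P t := (potential_prod G t (psi t)).
Local Notation Q s := (potential_prod G' s (phi s)).
Local Notation Z t := (partition_fun mu G A t (psi t)).
Local Notation Y s := (partition_fun mu G' A s (phi s)).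
Local Notation k t := (conditional_factor mu G A t (psi t)).
Local Notation l s := (conditional_factor mu G' A s (phi s)).

(** The sets [s :\: A] over the blocks [s] partition [t :\: A], and [c] is constant in these
    variables: it comes out of the integral, and the rest splits by [iter_int_prod]. *)
Lemma partition_fun_refinement t (c : prodspace X -> R) : t \in chain_components G ->
  on_coords (~: (t :\: A))%SET c -> (forall x, 0 <= c x) ->
  (forall x, P t (subst x) = c x * \prod_(s in refinement G A t) Q s (subst x)) ->
  forall x, Z t (subst x) =
    ((c x)%:E * \prod_(s in refinement G A t) Y s (subst x))%E.
Proof.
move=> tG hc c0 Pc x; pose D := refinement G A t.
have DG s : s \in D -> s \in chain_components G' by rewrite inE => /andP[].
have notA (s : {set V}) : {in enum (s :\: A)%SET, forall v, v \notin A}.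
  by move=> v; rewrite mem_enum finset.in_setD => /andP[].
pose F s y := (Q s (subst y))%:E.
have mF s : s \in D -> measurable_fun setT (F s).
  move=> /DG sG; apply/measurable_EFinP.
  apply: measurableT_comp; last exact: measurable_subst.
  exact: measurable_potential_prod phiP _ sG.
have F0 s y : s \in D -> (0 <= F s y)%E.
  by move=> /DG sG; rewrite lee_fin; exact: (potential_prod_ge0 phiP).
have [|||mD iD] := @iter_int_prod _ _ _ _ mu _ D (fun s => s :\: A)%SET
  (fun s => (s :|: pa_set G' s) :\: A)%SET F mF F0.
- move=> s /DG sG; have := on_coords_subst a0 (on_coords_potential_prod phiP sG).
  by move=> H y z yz; congr EFin; exact: H.
- by move=> s _; apply: finset.setSD; exact: finset.subsetUl.
(* A variable of block [r] is neither in another block [s] nor, being in [t], a parent of [s]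
   outside [A]. *)
- move=> s r v sD rD sr /finset.setDP[vsp vA]; apply/negP => /finset.setDP[vr _].
  have st : saturation G s = t by move: sD; rewrite inE => /andP[_ /eqP].
  have vt : v \in t.
    by apply: fintype.subsetP vr; move: rD; rewrite inE => /andP[_ /eqP <-]; exact: sub_saturation.
  case/finset.setUP: vsp => [vs|vp].
    by move/eqP: sr; apply; exact: (chain_component_disjoint (DG _ sD) (DG _ rD) vs vr).
  have := redirect_parent_outside (DG _ sD) vp vA.
  by rewrite st => /pa_setP[]; rewrite vt.
transitivity (iter_int mu (enum (t :\: A)%SET)
    (fun y => (c y)%:E * \prod_(s in D) F s y)%E x).
  rewrite (partition_funE mu A psiP tG).
  have /(congr1 (@^~ x))/= <- := iter_int_subst mu a0 (EFin \o P t) (notA t).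
  congr (iter_int _ _ _ x); apply/funext => y /=.
  by rewrite Pc EFinM prodEFin.
rewrite (@iter_int_scale _ _ _ _ _ (~: (t :\: A))%SET)//.
- rewrite -(refinement_cover A tG) iD; congr (_ * _)%E; apply: eq_bigr => s sD.
  rewrite (partition_funE mu A phiP (DG _ sD)).
  by have /(congr1 (@^~ x))/= <- := iter_int_subst mu a0 (EFin \o Q s) (notA s).
- by move=> y z yz; congr EFin; exact: hc.
- by move=> v; rewrite mem_enum => vt; rewrite finset.in_setC vt.
- by move=> y; apply: prode_ge0 => s; exact: F0.
Qed.

Lemma prod_refinement (F : {set V} -> R) :
  \prod_(s in chain_components G') F s =
  \prod_(t in chain_components G) \prod_(s in refinement G A t) F s.
Proof.
rewrite (partition_big (saturation G) (mem (chain_components G))); last first.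
  by move=> s; exact: saturation_chain.
by apply: eq_bigr => t _; apply: eq_bigl => s; rewrite inE.
Qed.

(** Where [c t] is nonzero and the block normalizers are finite, it cancels between factor and
    normalizer; elsewhere the factor of [t] is 0. *)
Lemma factors_le_refinement (c : {set V} -> prodspace X -> R) x :
  (forall t, t \in chain_components G ->
    [/\ on_coords (~: (t :\: A))%SET (c t), forall x, 0 <= c t x &
    forall x, P t (subst x) = c t x * \prod_(s in refinement G A t) Q s (subst x)]) ->
  \prod_(t in chain_components G) k t (subst x) <=
  \prod_(s in chain_components G') l s (subst x).
Proof.
move=> H; rewrite prod_refinement; apply: ler_prod => t tG.
have [hc c0 Pc] := H _ tG; rewrite (conditional_factor_ge0 mu A psiP)//=.
rewrite /conditional_factor (partition_fun_refinement tG hc c0 Pc) Pc.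
apply: normalized_le_prod => s; rewrite inE => /andP[sG _].
- exact: (partition_fun_ge0 mu A phiP).
- exact: (potential_prod_ge0 phiP).
Qed.

(** With no extra function left over, the previous computation applies with the constant 1, and
    [prod_le_normalized] gives the comparison in the opposite direction. *)
Lemma refinement_le_factors x :
  (forall t, t \in chain_components G ->
    forall x, P t (subst x) = \prod_(s in refinement G A t) Q s (subst x)) ->
  \prod_(s in chain_components G') l s (subst x) <=
  \prod_(t in chain_components G) k t (subst x).
Proof.
move=> H; rewrite prod_refinement; apply: ler_prod => t tG.
apply/andP; split.
  apply: prodr_ge0 => s; rewrite inE => /andP[sG _].
  exact: (conditional_factor_ge0 mu A phiP).
have := @partition_fun_refinement _ (cst 1) tG.
rewrite {2}/conditional_factor (H _ tG) => ->//; last by move=> y; rewrite mul1r H.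
rewrite mul1e; apply: prod_le_normalized => s; rewrite inE => /andP[sG _].
- exact: (partition_fun_ge0 mu A phiP).
- exact: (potential_prod_ge0 phiP).
Qed.

End Comparison.

(** * Transferring potentials between the cliques of the two graphs *)

Section Transfer.
Context {R : realType} {V : finType} {d : V -> measure_display}.
Context {X : forall v, measurableType (d v)}.
Variables (A : {set V}) (a0 : prodspace X) (G : chain_graph V).
Let G' := redirect G A.
Implicit Types (x y : prodspace X) (t s h m : {set V}).
Local Notation subst := (subst A a0).

Lemma is_potential_prod (I : finType) (D : pred I) m (F : I -> prodspace X -> R) :
  (forall i, D i -> is_potential m (F i)) ->
  is_potential m (fun x => \prod_(i | D i) F i x).
Proof.
move=> H; split.
- by apply: measurable_prod_cond => i /H[].
- by move=> x; apply: prodr_ge0 => i /H[].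
- by apply: on_coords_prod => i /H[].
Qed.

Lemma is_potential_subst h m (f : prodspace X -> R) : is_potential h f ->
  (h :\: A)%SET \subset m -> is_potential m (f \o subst).
Proof.
move=> [mf f0 hf] hm; split => //.
- by apply: measurableT_comp => //; exact: measurable_subst.
- by move=> x; exact: f0.
- exact: on_coords_sub hm (on_coords_subst a0 hf).
Qed.

Local Notation cliques K t := (moral_cliques K (t :|: pa_set K t)%SET).
Local Notation host K t h := (containing_clique K (t :|: pa_set K t)%SET (h :\: A)%SET).

(* Interventional coordinates are frozen at a0, so that the potential of h only
   depends on the coordinates in h minus A. *)
Definition split_potential (psi : {set V} -> {set V} -> prodspace X -> R) s m x : R :=
  \prod_(h in cliques G (saturation G s) |
           ((h :\: A) :&: s != finset.set0)%SET && (host G' s h == m))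
     psi (saturation G s) h (subst x).

(** No clique is left out here: by [redirect_clique_complete] each clique of a block, once [A] is
    removed, has a host in [G]. *)
Definition merge_potential (phi : {set V} -> {set V} -> prodspace X -> R) t m x : R :=
  \prod_(s in refinement G A t) \prod_(h in cliques G' s | host G t h == m)
    phi s h (subst x).

Lemma refinementP t s : s \in refinement G A t ->
  s \in chain_components G' /\ saturation G s = t.
Proof. by rewrite inE => /andP[-> /eqP]. Qed.

Section Split.
Variable psi : {set V} -> {set V} -> prodspace X -> R.
Hypothesis psiP : forall t h, t \in chain_components G ->
  h \in cliques G t -> is_potential h (psi t h).

Lemma host_splitP s h : s \in chain_components G' ->
  h \in cliques G (saturation G s) -> ((h :\: A) :&: s != finset.set0)%SET ->
  host G' s h \in cliques G' s /\ (h :\: A)%SET \subset host G' s h.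
Proof.
move=> sG hG /finset.set0Pn[v vhs].
exact/containing_cliqueP/(clique_redirect_complete sG hG vhs).
Qed.

Lemma split_potentialP s m : s \in chain_components G' -> m \in cliques G' s ->
  is_potential m (split_potential psi s m).
Proof.
move=> sG _; apply: is_potential_prod => h /andP[hG /andP[hs /eqP hm]].
apply: is_potential_subst; first exact: (psiP (saturation_chain sG) hG).
by have [_] := host_splitP sG hG hs; rewrite hm.
Qed.

Lemma split_potential_prod s x : s \in chain_components G' ->
  potential_prod G' s (split_potential psi s) x =
  \prod_(h in cliques G (saturation G s) | ((h :\: A) :&: s != finset.set0)%SET)
     psi (saturation G s) h (subst x).
Proof.
move=> sG; rewrite (partition_big (fun h => host G' s h) (mem (cliques G' s))).
  by apply: eq_bigr => m _; apply: eq_bigl => h; rewrite andbA.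
by move=> h /andP[hG hs]; case: (host_splitP sG hG hs).
Qed.

(* The cliques that miss t minus A belong to no block of the refinement; their
   potentials cancel against the normalizer wherever it is positive. *)
Definition parent_potential t x : R :=
  \prod_(h in cliques G t | ((h :\: A) :&: t == finset.set0)%SET) psi t h (subst x).

(** A clique meeting [t] outside [A] meets exactly one block there, so its potential occurs exactly
    once on the right; all other cliques are collected in [parent_potential]. *)
Lemma split_factorization t : t \in chain_components G ->
  [/\ on_coords (~: (t :\: A))%SET (parent_potential t),
    forall x, 0 <= parent_potential t x &
    forall x, potential_prod G t (psi t) (subst x) = parent_potential t x *
      \prod_(s in refinement G A t) potential_prod G' s (split_potential psi s) (subst x)].
Proof.
move=> tG; split.
- apply: on_coords_prod => h /andP[hG /eqP ht].
  have [_ _ hh] := psiP tG hG.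
  apply: on_coords_sub (on_coords_subst a0 hh); apply/fintype.subsetP => v vh.
  rewrite finset.in_setC; apply/negP => /finset.setDP[vt _].
  by have := finset.in_set0 v; rewrite -ht finset.in_setI vh vt.
- by move=> x; apply: prodr_ge0 => h /andP[hG _]; case: (psiP tG hG).
move=> x; rewrite /potential_prod (bigID (fun h => (h :\: A) :&: t == finset.set0)%SET)/=.
congr (_ * _).
(* The block of a clique is computed by saturating in the redirected graph, independently of the
   vertex [v] chosen in it; this is the key for grouping. *)
have block h v : h \in cliques G t -> v \in ((h :\: A) :&: t)%SET ->
    saturation G' ((h :\: A) :&: t)%SET = component G' v.
  move=> hG vh; apply/setP => w; rewrite !inE; apply/exists_inP/idP.
    by case=> u uh; apply: connect_trans; exact: (clique_connected tG hG).
  by exists v.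
rewrite (partition_big (fun h => saturation G' ((h :\: A) :&: t)%SET)
   (mem (refinement G A t))); last first.
  move=> h /andP[hG /finset.set0Pn[v vh]]; rewrite (block _ _ hG vh).
  change (component G' v \in refinement G A t); rewrite inE component_chain.
  rewrite (saturation_component (component_chain G' v) (mem_component G' v)).
  by case/finset.setIP: vh => _ vt; rewrite -(chain_componentE tG vt) eqxx.
apply: eq_bigr => s sD.
have [sG st] := refinementP sD.
rewrite -/(potential_prod G' s (split_potential psi s) (subst x)).
rewrite split_potential_prod// st; apply: eq_big => [h|h _]; last by rewrite substK.
rewrite -andbA; apply: andb_id2l => hG; apply/andP/idP.
  case=> /finset.set0Pn[v vh]; rewrite (block _ _ hG vh) => /eqP <-.
  apply/finset.set0Pn; exists v; move: vh; rewrite !finset.in_setI => /andP[-> _].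
  exact: mem_component.
case/finset.set0Pn => v /finset.setIP[vh vs].
have vht : v \in ((h :\: A) :&: t)%SET.
  by rewrite finset.in_setI vh -st; apply: fintype.subsetP vs; exact: sub_saturation.
split; first by apply/finset.set0Pn; exists v.
by rewrite (block _ _ hG vht) (chain_componentE sG vs).
Qed.

End Split.

Section Merge.
Variable phi : {set V} -> {set V} -> prodspace X -> R.
Hypothesis phiP : forall s h, s \in chain_components G' ->
  h \in cliques G' s -> is_potential h (phi s h).

Lemma host_mergeP s h : s \in chain_components G' -> h \in cliques G' s ->
  host G (saturation G s) h \in cliques G (saturation G s) /\
  (h :\: A)%SET \subset host G (saturation G s) h.
Proof.
by move=> sG hG; exact/containing_cliqueP/redirect_clique_complete.
Qed.

Lemma merge_potentialP t m : t \in chain_components G -> m \in cliques G t ->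
  is_potential m (merge_potential phi t m).
Proof.
move=> tG _; apply: is_potential_prod => s /refinementP[sG st].
apply: is_potential_prod => h /andP[hG /eqP hm].
apply: is_potential_subst; first exact: (phiP sG hG).
by have [_] := host_mergeP sG hG; rewrite st hm.
Qed.

(** After exchanging the products over hosts and blocks, each clique of a block is counted once, at
    its unique host. *)
Lemma merge_factorization t x : t \in chain_components G ->
  potential_prod G t (merge_potential phi t) (subst x) =
  \prod_(s in refinement G A t) potential_prod G' s (phi s) (subst x).
Proof.
move=> tG; rewrite /potential_prod exchange_big/=; apply: eq_bigr => s /refinementP[sG st].
rewrite [RHS](partition_big (fun h => host G t h) (mem (cliques G t)))/=.
  by apply: eq_bigr => m _; apply: eq_bigr => h _; rewrite substK.
by move=> h hG; case: (host_mergeP sG hG); rewrite st.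
Qed.

End Merge.
End Transfer.

Theorem theorem6 (R : realType) (V : finType) (d : V -> measure_display)
    (X : forall v : V, measurableType (d v))
    (mu : forall v : V, {sigma_finite_measure set (X v) -> \bar R})
    (G : chain_graph V) (A : {set V}) (a0 : prodspace X) :
  same_factorization mu G (redirect G A) A a0.
Proof.
move=> f fd; split=> -[fA [psi [psiP fE]]]; split => //.
(* From [G] to the redirected graph: the new product dominates, possibly strictly where a parent
   potential vanishes. *)
- pose phi := split_potential A a0 G psi.
  have phiP t h := @split_potentialP _ _ _ _ A a0 G psi psiP t h.
  exists phi; split => //.
  apply: (density_dominated fd) fE _.
  + apply: measurable_prod_cond => t; exact: measurable_conditional_factor.
  + by move=> x; apply: prodr_ge0 => t; exact: conditional_factor_ge0.
  + exact: integral_factors_le1.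
  move=> x; apply: (factors_le_refinement mu psiP phiP) => t tG.
  exact: split_factorization psiP _ tG.
(* Back to [G]: now the product over the components of [G] is the dominating one. *)
- pose phi := merge_potential A a0 G psi.
  have phiP t h := @merge_potentialP _ _ _ _ A a0 G psi psiP t h.
  exists phi; split => //.
  apply: (density_dominated fd) fE _.
  + apply: measurable_prod_cond => t; exact: measurable_conditional_factor.
  + by move=> x; apply: prodr_ge0 => t; exact: conditional_factor_ge0.
  + exact: integral_factors_le1.
  move=> x; apply: (refinement_le_factors mu phiP psiP) => t tG y.
  exact: merge_factorization.
Qed.
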